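(* Let $Q:\mathbb R^{2\times2}_{\rm sym}\to\mathbb R$ be a positive definite quadratic form that is orthotropic with coefficients $q_1,q_2,q_{12},q_3$, and let $B\in\mathbb R^{2\times2}$ be diagonal with $\det B\ne0$. Let $\mathcal S_{Q,B}=\operatorname{argmin}_{G\in\mathcal G}Q(G-B)$. Then exactly one of the following three cases holds: (a) (Axial minimizers) All minimizers $G\in\mathcal S_{Q,B}$ are axial. In this case $$\emptyset\ne\mathcal S_{Q,B}\subseteq\Big\{\tfrac{2q_1\widehat B_1+q_{12}\widehat B_2}{2q_1}\,G_1,\ \tfrac{q_{12}\widehat B_1+2q_2\widehat B_2}{2q_2}\,G_2\Big\},$$ and equality holds if and only if $\frac{(\widehat B_2)^2}{q_1}=\frac{(\widehat B_1)^2}{q_2}$. (b) (Two non-axial minimizers) $\det H>0$ and $g_*:=2H^{-1}Ab$ is an interior point of $\mathcal G^+_{\mathbb R^2}$. In this case $\mathcal S_{Q,B}=\{G,TG\}$ with $G:=\Phi(g_* )$. (c) (One-parameter family of minimizers) $\det H=0$ and $Ab\in\operatorname{range}H$. In this case $$\mathcal S_{Q,B}=\{G,TG\,:\,G=\Phi(a)\text{ for some }a\in\mathcal G^+_{\mathbb R^2}\text{ with }a\cdot q_*=s_*\},$$ where $$q_*:=\frac1{\sqrt{(q_{12}+2q_3)^2+4q_2^2}}\begin{pmatrix} q_{12}+2q_3 \\ 2q_2 \end{pmatrix},\qquad s_*:=\frac{q_*\cdot Ab}{q_1+q_2}.$$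
   Context: $\mathbb R^{2\times2}_{\rm sym}$ has the orthonormal basis $G_1=e_1\otimes e_1$, $G_2=e_2\otimes e_2$, $G_3=\frac1{\sqrt2}(e_1\otimes e_2+e_2\otimes e_1)$; the coefficients $\widehat G_1,\widehat G_2,\widehat G_3$ of $G\in\mathbb R^{2\times2}_{\rm sym}$ are defined by $G=\sum_i\widehat G_iG_i$ (likewise $\widehat B_i$ for $B$). A quadratic form $Q$ on $\mathbb R^{2\times2}_{\rm sym}$ is orthotropic with coefficients $q_1,q_2,q_{12},q_3\in\mathbb R$ if $Q(G)=\widehat G_1^2q_1+\widehat G_1\widehat G_2q_{12}+\widehat G_2^2q_2+\widehat G_3^2q_3$ for all $G$. $\mathcal G=\{G\in\mathbb R^{2\times2}_{\rm sym}:\det G=0\}$. A matrix $G\in\mathcal G\setminus\{0\}$ is axial if $G\in\operatorname{span}\{G_1\}\cup\operatorname{span}\{G_2\}$. $T:\mathcal G\to\mathcal G$ maps $\begin{pmatrix} a_1 & a_3 \\ a_3 & a_2 \end{pmatrix}$ to $\begin{pmatrix} a_1 & -a_3 \\ -a_3 & a_2 \end{pmatrix}$. $\mathcal G^+_{\mathbb R^2}=\{a=(a_1,a_2)\in\mathbb R^2:a_1a_2\ge0\}$ and $\Phi:\mathcal G^+_{\mathbb R^2}\to\mathcal G$, $\Phi(a_1,a_2)=a_1G_1+a_2G_2+\sqrt{2a_1a_2}\,G_3$. Moreover $$H=\begin{pmatrix} 2q_1 & q_{12}+2q_3 \\ {q_{12}}+2q_3 & 2q_2 \end{pmatrix},\quad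 A=\begin{pmatrix} q_1 & \frac{q_{12}}2 \\ \frac{q_{12}}2 & q_2 \end{pmatrix},\quad b=(\widehat B_1,\widehat B_2)^\top.$$ *)

(* Defs.v *)
From HB Require Import structures.
From mathcomp Require Import all_boot all_order all_algebra.
From mathcomp Require Import classical_sets reals topology normedtype.

Set Implicit Arguments.
Unset Strict Implicit.
Unset Printing Implicit Defensive.

Import Order.TTheory GRing.Theory Num.Theory.
Import numFieldNormedType.Exports.
Local Open Scope classical_set_scope.
Local Open Scope ring_scope.

Section Matrices22.
Variable R : realType.

Definition mx22 (a b c d : R) : 'M[R]_2 :=
  \matrix_(i < 2, j < 2) nth 0 (nth [::] [:: [:: a; b]; [:: c; d]] i) j.

Definition cv2 (x y : R) : 'cV[R]_2 := \col_(i < 2) nth 0 [:: x; y] i.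

Definition dotv (u v : 'cV[R]_2) : R := \sum_(i < 2) u i 0 * v i 0.

Lemma mx22P (M N : 'M[R]_2) :
  M 0 0 = N 0 0 -> M 0 1 = N 0 1 -> M 1 0 = N 1 0 -> M 1 1 = N 1 1 -> M = N.
Proof.
move=> h00 h01 h10 h11; apply/matrixP => i j.
have E (k : 'I_2) : k = 0 \/ k = 1.
  by case: k => -[|[|//]] hk; [left | right]; apply/val_inj.
by case: (E i) => ->; case: (E j) => ->.
Qed.

Lemma det_mx22 (M : 'M[R]_2) : \det M = M 0 0 * M 1 1 - M 0 1 * M 1 0.
Proof.
rewrite (expand_det_row _ 0) !big_ord_recl big_ord0 /cofactor !det_mx11 !mxE.
rewrite /= expr0 expr1 mul1r mulN1r addr0 mulrN.
by congr (M _ _ * M _ _ - M _ _ * M _ _); apply/val_inj.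
Qed.

Definition symmx2 : pred 'M[R]_2 := [pred M | M^T == M].

Lemma symmx2_submod_closed : submod_closed symmx2.
Proof.
split; first by rewrite inE trmx0.
by move=> c M N; rewrite !inE linearP /= => /eqP -> /eqP ->.
Qed.

End Matrices22.

Record symM2 (R : realType) := SymM2 {
  symM2_val :> 'M[R]_2;
  symM2P : symmx2 symM2_val }.

Section SymmetricMatrices.
Variable R : realType.
Implicit Types (G : symM2 R) (a : 'cV[R]_2).

HB.instance Definition _ := [isSub for @symM2_val R].
HB.instance Definition _ := [Choice of symM2 R by <:].
HB.instance Definition _ := GRing.SubChoice_isSubLmodule.Build
  R 'M[R]_2 (@symmx2 R) (symM2 R) (@symmx2_submod_closed R).

Lemma sym22_subproof (a1 a2 a3 : R) : symmx2 (mx22 a1 a3 a3 a2).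
Proof. by apply/eqP/mx22P; rewrite !mxE. Qed.

(* The symmetric matrix with diagonal (a1, a2) and off-diagonal entry a3. *)
Definition sym22 (a1 a2 a3 : R) : symM2 R := SymM2 (sym22_subproof a1 a2 a3).

Lemma symM2C G : G 1 0 = G 0 1.
Proof. by have /eqP/matrixP/(_ 0 1) := symM2P G; rewrite mxE. Qed.

Lemma sym22E G : G = sym22 (G 0 0) (G 1 1) (G 0 1).
Proof. by apply/val_inj/mx22P; rewrite !mxE //= symM2C. Qed.

Lemma symM2D G G' : symM2_val (G + G') = symM2_val G + symM2_val G'.
Proof. by []. Qed.

Lemma symM2Z (c : R) G : symM2_val (c *: G) = c *: symM2_val G.
Proof. by []. Qed.

Fact symM2_vect_axiom : Vector.axiom 3 (symM2 R).
Proof.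
exists (fun G => \row_(i < 3) [:: G 0 0; G 1 1; G 0 1]`_i).
  move=> c G G'; apply/rowP => i; rewrite !mxE.
  by case: i => -[|[|[|//]]].
exists (fun v : 'rV[R]_3 => sym22 (v 0 0) (v 0 1) (v 0 ord_max)) => [G|v].
  by rewrite [RHS]sym22E; apply/val_inj/mx22P; rewrite !mxE.
apply/rowP => -[[|[|[|//]]] hi]; rewrite !mxE /=;
  by congr (v _ _); apply/val_inj.
Qed.
HB.instance Definition _ := Lmodule_hasFinDim.Build R (symM2 R) symM2_vect_axiom.

Definition G1 : symM2 R := sym22 1 0 0.
Definition G2 : symM2 R := sym22 0 1 0.
Definition G3 : symM2 R := (Num.sqrt 2)^-1 *: sym22 0 0 1.

Definition symbasis : 3.-tuple (symM2 R) := [tuple G1; G2; G3].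

Definition hat1 G : R := coord symbasis 0 G.
Definition hat2 G : R := coord symbasis 1 G.
Definition hat3 G : R := coord symbasis ord_max G.

Lemma sqrt2_neq0 : Num.sqrt 2 != 0 :> R.
Proof. by rewrite sqrtr_eq0 -ltNge ltr0n. Qed.

Lemma symbasis_comb (c1 c2 c3 : R) :
  c1 *: G1 + c2 *: G2 + c3 *: G3 = sym22 c1 c2 ((Num.sqrt 2)^-1 * c3).
Proof.
by apply/val_inj/mx22P; do 3?rewrite !mxE /=;
  rewrite ?mulr1 ?mulr0 ?addr0 ?add0r // mulrC.
Qed.

Lemma symbasis_sum (k : 'I_3 -> R) :
  \sum_(i < 3) k i *: symbasis`_i = k 0 *: G1 + k 1 *: G2 + k ord_max *: G3.
Proof.
rewrite !big_ord_recl big_ord0 /= addr0 addrA.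
by congr (_ *: _ + _ *: _ + _ *: _); congr (k _); apply/val_inj.
Qed.

Lemma symbasis_free : free symbasis.
Proof.
apply/freeP => k; rewrite symbasis_sum symbasis_comb.
move=> /(congr1 (@symM2_val R))/matrixP hk.
have := hk 0 0; have := hk 1 1; have := hk 0 1; rewrite !mxE /=.
move=> /eqP; rewrite mulf_eq0 invr_eq0 (negPf sqrt2_neq0) /= => /eqP h3 h2 h1.
case=> -[|[|[|//]]] hi.
- by rewrite -h1; congr (k _); apply/val_inj.
- by rewrite -h2; congr (k _); apply/val_inj.
- by rewrite -h3; congr (k _); apply/val_inj.
Qed.

Lemma hat_comb (c1 c2 c3 : R) (G := c1 *: G1 + c2 *: G2 + c3 *: G3) :
  [/\ hat1 G = c1, hat2 G = c2 & hat3 G = c3].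
Proof.
pose k (i : 'I_3) := [:: c1; c2; c3]`_i.
have -> : G = \sum_(i < 3) k i *: symbasis`_i by rewrite symbasis_sum.
by split; rewrite [LHS]coord_sum_free ?symbasis_free.
Qed.

Lemma hatE G :
  [/\ hat1 G = G 0 0, hat2 G = G 1 1 & hat3 G = Num.sqrt 2 * G 0 1].
Proof.
have e : G = G 0 0 *: G1 + G 1 1 *: G2 + (Num.sqrt 2 * G 0 1) *: G3.
  by rewrite symbasis_comb mulKf ?sqrt2_neq0 // -sym22E.
by have := hat_comb (G 0 0) (G 1 1) (Num.sqrt 2 * G 0 1); rewrite -e.
Qed.

Lemma hat_expand G : G = hat1 G *: G1 + hat2 G *: G2 + hat3 G *: G3.
Proof.
have [-> -> ->] := hatE G.
by rewrite symbasis_comb mulKf ?sqrt2_neq0 // -sym22E.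
Qed.

Definition quadratic_form (Q : symM2 R -> R) :=
  exists beta : {bilinear symM2 R -> symM2 R -> R | *%R & *%R},
    forall G, Q G = beta G G.

Definition positive_definite (Q : symM2 R -> R) := forall G, G != 0 -> 0 < Q G.

Definition orthotropic (Q : symM2 R -> R) (q1 q2 q12 q3 : R) :=
  forall G, Q G = hat1 G ^+ 2 * q1 + hat1 G * hat2 G * q12
                  + hat2 G ^+ 2 * q2 + hat3 G ^+ 2 * q3.

Definition calG : set (symM2 R) := [set G | \det G = 0].

Definition axial G := [/\ calG G, G != 0 & G \in <[G1]>%VS \/ G \in <[G2]>%VS].

(* Tmap and Phi are total functions; they are meant on calG and calGplus. *)
Definition Tmap G : symM2 R := sym22 (G 0 0) (G 1 1) (- G 0 1).

Definition calGplus : set 'cV[R]_2 := [set a | 0 <= a 0 0 * a 1 0].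

Definition Phi a : symM2 R :=
  a 0 0 *: G1 + a 1 0 *: G2 + Num.sqrt (2 * a 0 0 * a 1 0) *: G3.

Lemma det_sym22 (a1 a2 a3 : R) : \det (sym22 a1 a2 a3) = a1 * a2 - a3 ^+ 2.
Proof. by rewrite det_mx22 !mxE. Qed.

Lemma Tmap_calG G : calG G -> calG (Tmap G).
Proof.
by rewrite /calG /= {1}[G]sym22E /Tmap !det_sym22 sqrrN.
Qed.

Lemma Phi_calG a : calGplus a -> calG (Phi a).
Proof.
rewrite /calGplus /= => ha; rewrite /calG.
have -> : Phi a = sym22 (a 0 0) (a 1 0) _ := symbasis_comb _ _ _.
change (\det (sym22 (a 0 0) (a 1 0)
  ((Num.sqrt 2)^-1 * Num.sqrt (2 * a 0 0 * a 1 0))) = 0).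
rewrite det_sym22.
rewrite exprMn exprVn !sqr_sqrtr ?ler0n //; last first.
  by rewrite -mulrA mulr_ge0 ?ler0n.
by rewrite -mulrA mulKf ?subrr // pnatr_eq0.
Qed.

Definition Hmx (q1 q2 q12 q3 : R) : 'M[R]_2 :=
  mx22 (2 * q1) (q12 + 2 * q3) (q12 + 2 * q3) (2 * q2).

Definition Amx (q1 q2 q12 : R) : 'M[R]_2 := mx22 q1 (q12 / 2) (q12 / 2) q2.

Definition qstar (q2 q12 q3 : R) : 'cV[R]_2 :=
  (Num.sqrt ((q12 + 2 * q3) ^+ 2 + 4 * q2 ^+ 2))^-1
    *: cv2 (q12 + 2 * q3) (2 * q2).

End SymmetricMatrices.

Arguments G1 {R}.
Arguments G2 {R}.
Arguments G3 {R}.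
Arguments calG {R}.
Arguments calGplus {R}.

Definition argmin (X : Type) (R : realType) (D : set X) (f : X -> R) : set X :=
  [set x | D x /\ forall y, D y -> f x <= f y].

Definition exactly_one_of3 (P1 P2 P3 : Prop) : Prop :=
  [\/ P1, P2 | P3] /\ [/\ ~ (P1 /\ P2), ~ (P1 /\ P3) & ~ (P2 /\ P3)].

(* Main.v *)
Require Import Defs.
From mathcomp Require Import all_boot all_order all_algebra.
From mathcomp Require Import classical_sets reals topology normedtype.
From mathcomp Require Import boolp derive ring lra.

Set Implicit Arguments.
Unset Strict Implicit.
Unset Printing Implicit Defensive.

Import Order.TTheory GRing.Theory Num.Theory.
Import numFieldNormedType.Exports.
Local Open Scope classical_set_scope.
Local Open Scope ring_scope.

(** A singular symmetric matrix with diagonal (x, y) has x y >= 0 and its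
off-diagonal entry is determined up to sign. Since B is diagonal, Q (G - B)
sees the off-diagonal entry only through its square x y. So the problem is to
minimize over the double cone x y >= 0 of the plane the quadratic function
[objective], whose Hessian is H and whose linear part is - 2 A b; the
two signs of the off-diagonal entry account for G and T G ([argminP],
[Phi_fiberP]).

Positive definiteness of Q makes the quadratic part positive on the cone away
from the origin even if H is indefinite, so a minimizer exists
([cone_min_exists]). At a minimizer off the axes the gradient vanishes and H is
positive semidefinite ([interior_min_critical], [interior_min_disc]).
If det H > 0, the minimizer is then the vertex g_* = 2 H^-1 A b; conversely,
when det H > 0 and g_* lies in the cone, strict convexity makes it the only
minimizer. If det H = 0, the equation H a = 2 A b has a solution only if A b is
in the range of H. Its solutions then form a line orthogonal to q_*, and by
convexity the minimizers in the cone are the points of the cone on this line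
([degenerate_cone_minP]). Orthotropic positivity forces q12 + 2 q3 > 0 in that
case, so the line has negative slope, and it misses the origin because
A b != 0; hence it crosses the open cone, and the family contains
non-axial matrices.

In the remaining case every minimizer is on an axis. The origin is not one,
since both one-variable restrictions would be minimal there, which forces
A b = 0 and then B = 0. On each axis the minimum is at an explicit point, and
the two minimal values differ by a positive multiple of
b1^2 / q2 - b2^2 / q1 ([axis_energyE]). *)

(** * Quadratic functions on the double cone x y >= 0 *)

Section ConeQuadratic.
Variables (R : realType) (p k r w1 w2 : R).

Definition qform (x y : R) := p * x ^+ 2 + k * x * y + r * y ^+ 2.
Definition objective (x y : R) := qform x y - w1 * x - w2 * y.

Definition cone_min (x y : R) :=
  0 <= x * y /\
  forall x' y', 0 <= x' * y' -> objective x y <= objective x' y'.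

Definition critical (x y : R) :=
  2 * p * x + k * y = w1 /\ k * x + 2 * r * y = w2.

(** Exact Taylor expansion; the linear coefficients are the gradient. *)
Lemma objective_expand (x y u v : R) :
  objective (x + u) (y + v) =
  objective x y + (2 * p * x + k * y - w1) * u
  + (k * x + 2 * r * y - w2) * v + qform u v.
Proof. by rewrite /objective /qform; ring. Qed.

Lemma objective_critical (x y x' y' : R) :
  critical x y -> objective x' y' = objective x y + qform (x' - x) (y' - y).
Proof.
move=> [e1 e2]; rewrite -{1}(subrK x x') -{1}(subrK y y').
rewrite [x' - x + x]addrC [y' - y + y]addrC objective_expand e1 e2; ring.
Qed.

Lemma qform_square (x y : R) :
  4 * p * qform x y = (2 * p * x + k * y) ^+ 2 + (4 * p * r - k ^+ 2) * y ^+ 2.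
Proof. by rewrite /qform; ring. Qed.

Lemma qform_ge0 (x y : R) : 0 < p -> k ^+ 2 <= 4 * p * r -> 0 <= qform x y.
Proof.
move=> p0 kpr; have p4 : 0 < 4 * p by rewrite mulr_gt0.
rewrite -(pmulr_rge0 _ p4) qform_square addr_ge0 ?sqr_ge0 //.
by rewrite mulr_ge0 ?sqr_ge0 ?subr_ge0.
Qed.

Lemma critical_cone_min (x y : R) : 0 < p -> k ^+ 2 <= 4 * p * r ->
  0 <= x * y -> critical x y -> cone_min x y.
Proof.
move=> p0 kpr xy cxy; split=> // x' y' _.
by rewrite (objective_critical x' y' cxy) lerDl qform_ge0.
Qed.

(** Once one minimizer is critical, the others are found by
testing the quadratic form of the difference. *)
Lemma cone_min_eq (x y x' y' : R) : critical x y -> cone_min x y ->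
  0 <= x' * y' -> qform (x' - x) (y' - y) <= 0 <-> cone_min x' y'.
Proof.
move=> cxy [xy mxy] xy'; have eqf u v := objective_critical u v cxy.
split=> [q0|[_ /(_ _ _ xy)]]; last by rewrite (eqf x') gerDl.
split=> // u v /mxy; apply: le_trans.
by rewrite (eqf x') gerDl.
Qed.

Lemma qform_eq0 (x y : R) : 0 < p -> k ^+ 2 < 4 * p * r ->
  qform x y <= 0 -> x = 0 /\ y = 0.
Proof.
move=> p0 kpr q0.
have p4 : 0 < 4 * p by rewrite mulr_gt0.
have d0 : 0 < 4 * p * r - k ^+ 2 by rewrite subr_gt0.
have : 4 * p * qform x y <= 0 by rewrite pmulr_rle0.
rewrite qform_square => s0.
have y0 : y = 0.
  apply/eqP; rewrite -[y == 0](exprn_even_le0 (n := 2)) // -(pmulr_rle0 _ d0).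
  by apply: le_trans s0; rewrite lerDr sqr_ge0.
move: s0; rewrite y0 expr0n /= !mulr0 !addr0 exprn_even_le0 //=.
by rewrite !mulf_eq0 pnatr_eq0 /= (gt_eqF p0) => /eqP.
Qed.

(** A parabola through the origin that is nonnegative on [-1, 1] has a
horizontal tangent there: a small step against the slope would make it
negative. *)
Lemma linear_coef_eq0 (a c : R) :
  (forall t, `|t| <= 1 -> 0 <= t * a + t ^+ 2 * c) -> a = 0.
Proof.
move=> H; have [//|a0] := eqVneq a 0; exfalso.
(* the step is - a / m; m >= |a| keeps it in [-1, 1], and m > c makes the
   linear term win *)
pose m := 1 + `|a| + `|c|.
have m1 : 0 < m by rewrite /m -addrA ltr_pwDl // addr_ge0.
have := H (- a / m); rewrite normrM normrN normfV (gtr0_norm m1).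
rewrite ler_pdivrMr // mul1r.
have -> : - a / m * a + (- a / m) ^+ 2 * c = (a / m) ^+ 2 * (c - m).
  by field; rewrite gt_eqF.
have am : `|a| <= m by rewrite /m; have := normr_ge0 c; lra.
move=> /(_ am); rewrite pmulr_rge0; last first.
  by rewrite exprn_even_gt0 //= mulf_neq0 // invr_eq0 gt_eqF.
by have := ler_norm c; have := normr_ge0 a; rewrite /m; lra.
Qed.

(** Rescaling the coordinates by factors in [0, 2] keeps a point in the cone,
so no smallness of the step has to be tracked; off the axes these variations
cover all directions. *)
Lemma scaled_cone (x y t s : R) :
  0 < x * y -> `|t| <= 1 -> `|s| <= 1 -> 0 <= (x + t * x) * (y + s * y).
Proof.
rewrite !ler_norml => xy /andP[t1 _] /andP[s1 _].
have -> : (x + t * x) * (y + s * y) = (1 + t) * (1 + s) * (x * y) by ring.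
by rewrite mulr_ge0 ?(ltW xy) // mulr_ge0 //; lra.
Qed.

Lemma interior_min_critical (x y : R) :
  0 < x * y -> cone_min x y -> critical x y.
Proof.
move=> xy [_ mxy].
have xy0 : x * y != 0 by rewrite gt_eqF.
move: (xy0); rewrite mulf_eq0 negb_or => /andP[x0 y0].
have n0 : `|0 : R| <= 1 by rewrite normr0.
split.
- apply/eqP; rewrite -subr_eq0 -(inj_eq (mulIf x0)) mul0r; apply/eqP.
  apply: (@linear_coef_eq0 _ (p * x ^+ 2)) => t t1.
  have := mxy _ _ (scaled_cone xy t1 n0).
  rewrite objective_expand /qform -subr_ge0 => /le_trans; apply.
  by rewrite le_eqVlt; apply/orP; left; apply/eqP; ring.
- apply/eqP; rewrite -subr_eq0 -(inj_eq (mulIf y0)) mul0r; apply/eqP.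
  apply: (@linear_coef_eq0 _ (r * y ^+ 2)) => t t1.
  have := mxy _ _ (scaled_cone xy n0 t1).
  rewrite objective_expand /qform -subr_ge0 => /le_trans; apply.
  by rewrite le_eqVlt; apply/orP; left; apply/eqP; ring.
Qed.

(** The gradient being zero, the quadratic form is nonnegative in every
direction; the direction (- k, 2 p), which minimizes it for a fixed second
coordinate, gives the discriminant. *)
Lemma interior_min_disc (x y : R) : 0 < p ->
  0 < x * y -> cone_min x y -> k ^+ 2 <= 4 * p * r.
Proof.
move=> p0 xy mxy; have cxy := interior_min_critical xy mxy.
case: mxy => _ mxy.
have xy0 : x * y != 0 by rewrite gt_eqF.
move: (xy0); rewrite mulf_eq0 negb_or => /andP[x0 y0].
(* dividing by m brings both scaling factors into [-1, 1] *)
pose t := - k / x; pose s := 2 * p / y; pose m := 1 + `|t| + `|s|.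
have m0 : 0 < m by rewrite /m -addrA ltr_pwDl // addr_ge0.
have tm : `|t / m| <= 1.
  rewrite normrM normfV (gtr0_norm m0) ler_pdivrMr // mul1r /m.
  by have := normr_ge0 s; lra.
have sm : `|s / m| <= 1.
  rewrite normrM normfV (gtr0_norm m0) ler_pdivrMr // mul1r /m.
  by have := normr_ge0 t; lra.
have := mxy _ _ (scaled_cone xy tm sm).
rewrite [leRHS](objective_critical _ _ cxy) lerDl.
have -> : qform (x + t / m * x - x) (y + s / m * y - y)
          = p / m ^+ 2 * (4 * p * r - k ^+ 2).
  by rewrite /qform /t /s; field; rewrite x0 y0 gt_eqF.
by rewrite pmulr_rge0 ?subr_ge0 // divr_gt0 // exprn_gt0.
Qed.

Lemma cone_min_axis1 (x : R) : 0 < p -> cone_min x 0 -> x = w1 / (2 * p).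
Proof.
move=> p0 [_ /(_ (w1 / (2 * p)) 0)]; rewrite mulr0 lexx => /(_ isT).
rewrite -subr_le0.
have -> : objective x 0 - objective (w1 / (2 * p)) 0
          = p * (x - w1 / (2 * p)) ^+ 2.
  by rewrite /objective /qform; field; rewrite gt_eqF.
by rewrite pmulr_rle0 // exprn_even_le0 //= subr_eq0 => /eqP.
Qed.

Lemma cone_min_axis2 (y : R) : 0 < r -> cone_min 0 y -> y = w2 / (2 * r).
Proof.
move=> r0 [_ /(_ 0 (w2 / (2 * r)))]; rewrite mul0r lexx => /(_ isT).
rewrite -subr_le0.
have -> : objective 0 y - objective 0 (w2 / (2 * r))
          = r * (y - w2 / (2 * r)) ^+ 2.
  by rewrite /objective /qform; field; rewrite gt_eqF.
by rewrite pmulr_rle0 // exprn_even_le0 //= subr_eq0 => /eqP.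
Qed.

(** Completed square along a line through the origin. *)
Lemma objective_line (u v t : R) : qform u v != 0 ->
  objective (t * u) (t * v) =
  qform u v * (t - (w1 * u + w2 * v) / (2 * qform u v)) ^+ 2
  - (w1 * u + w2 * v) ^+ 2 / (4 * qform u v).
Proof.
rewrite /objective => q0.
have -> : qform (t * u) (t * v) = t ^+ 2 * qform u v by rewrite /qform; ring.
by field.
Qed.

(** Every point of the cone lies on the line spanned by (1 - s, s) for some s
in [0, 1]. On that line the minimum is explicit, namely - g s below, so it
suffices that the continuous function g attains its maximum on [0, 1]. *)
Lemma cone_min_exists :
  (forall u v, 0 <= u * v -> (u, v) != (0, 0) -> 0 < qform u v) ->
  exists x y, cone_min x y.
Proof.
move=> qpos.
have qs (s : R) : s \in `[0, 1] -> 0 < qform (1 - s) s.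
  rewrite in_itv /= => /andP[s0 s1]; apply: qpos.
    by rewrite mulr_ge0 // subr_ge0.
  by apply/negP => /eqP[]; lra.
pose g (s : R) := (w1 * (1 - s) + w2 * s) ^+ 2 / (4 * qform (1 - s) s).
have cid : continuous (fun s : R => s) by move=> ?; exact: cvg_id.
have c1 : continuous (fun s : R => 1 - s).
  by move=> s; apply: cvgB; [exact: cvg_cst | exact: cvg_id].
have cM (f h : R -> R) : continuous f -> continuous h ->
    continuous (fun s : R => f s * h s : R).
  by move=> cf ch s; apply: cvgM; [exact: cf | exact: ch].
have cD (f h : R -> R) : continuous f -> continuous h ->
    continuous (fun s : R => f s + h s : R).
  by move=> cf ch s; apply: cvgD; [exact: cf | exact: ch].
have cc (c : R) : continuous (fun _ : R => c) by move=> s; exact: cvg_cst.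
have csq (f : R -> R) : continuous f -> continuous (fun s : R => f s ^+ 2 : R).
  by move=> cf; exact: (cM f f cf cf).
have gc : {within `[0, 1], continuous g}.
  apply: continuous_in_subspaceT => s /[!inE] /qs q0.
  have cnum := csq _ (cD _ _ (cM _ _ (cc w1) c1) (cM _ _ (cc w2) cid)).
  have cden := cM _ _ (cc 4) (cD _ _ (cD _ _ (cM _ _ (cc p) (csq _ c1))
    (cM _ _ (cM _ _ (cc k) c1) cid)) (cM _ _ (cc r) (csq _ cid))).
  apply: cvgM; first exact: cnum.
  by apply: cvgV; [rewrite mulf_neq0 // gt_eqF | exact: cden].
have [s0 s0I gmax] := EVT_max ler01 gc.
have q0 := qs _ s0I.
pose t0 := (w1 * (1 - s0) + w2 * s0) / (2 * qform (1 - s0) s0).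
exists (t0 * (1 - s0)), (t0 * s0).
have obj0 : objective (t0 * (1 - s0)) (t0 * s0) = - g s0.
  by rewrite objective_line ?gt_eqF // subrr expr0n mulr0 sub0r.
split.
  move: s0I; rewrite in_itv /= => /andP[s00 s01].
  by rewrite mulrACA -expr2 mulr_ge0 ?sqr_ge0 // mulr_ge0 // subr_ge0.
move=> x y xy; rewrite obj0.
have [xy0|xy0] := eqVneq (x, y) (0, 0).
  case: xy0 => -> ->.
  have -> : objective 0 0 = 0 by rewrite /objective /qform; ring.
  by rewrite oppr_le0 /g divr_ge0 ?sqr_ge0 // mulr_ge0 // ltW.
(* (x, y) is (x + y) times (1 - s, s) with s = y / (x + y) *)
have sq : 0 < (x + y) ^+ 2.
  have -> : (x + y) ^+ 2 = x ^+ 2 + y ^+ 2 + 2 * (x * y) by ring.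
  apply: ltr_wpDr; first by rewrite mulr_ge0.
  rewrite lt_neqAle addr_ge0 ?sqr_ge0 // andbT eq_sym.
  by rewrite paddr_eq0 ?sqr_ge0 // !sqrf_eq0; move: xy0; rewrite xpair_eqE.
have n0 : x + y != 0 by rewrite -sqrf_eq0 gt_eqF.
pose s := y / (x + y).
have sI : s \in `[0, 1].
  have sE : s = x * y / (x + y) ^+ 2 + (y / (x + y)) ^+ 2 by rewrite /s; field.
  have s1E : 1 - s = x * y / (x + y) ^+ 2 + (x / (x + y)) ^+ 2.
    by rewrite /s; field.
  have sge0 : 0 <= s by rewrite sE addr_ge0 ?sqr_ge0 // divr_ge0 // ltW.
  rewrite in_itv /= sge0 -subr_ge0 s1E addr_ge0 ?sqr_ge0 //.
  by rewrite divr_ge0 // ltW.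
have q1 := qs _ sI.
have q1' : qform (1 - s) s != 0 by rewrite gt_eqF.
have := objective_line (x + y) q1'.
have -> : (x + y) * (1 - s) = x by rewrite /s; field.
have -> : (x + y) * s = y by rewrite /s; field.
move=> ->; apply: (@le_trans _ _ (- g s)); first by rewrite lerN2 gmax.
by rewrite lerDr mulr_ge0 ?sqr_ge0 // ltW.
Qed.

(** When k^2 = 4 p r the two rows of the Hessian are proportional, so the two
equations for a critical point reduce to one. *)
Lemma degenerate_rows (x y : R) : k ^+ 2 = 4 * p * r ->
  k * (2 * p * x + k * y) = 2 * p * (k * x + 2 * r * y).
Proof.
move=> kpr; rewrite (_ : k * _ = 2 * p * k * x + k ^+ 2 * y); last by ring.
by rewrite kpr; ring.
Qed.

Lemma degenerate_critical (x y : R) : 0 < p ->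
  k ^+ 2 = 4 * p * r -> k * w1 = 2 * p * w2 ->
  2 * p * x + k * y = w1 -> critical x y.
Proof.
move=> p0 kpr kw e; split=> //; apply: (@mulfI _ (2 * p)).
  by rewrite mulf_neq0 // gt_eqF.
by rewrite -degenerate_rows // e.
Qed.

(** For k > 0 the critical line has negative slope, so off the origin it
crosses one of the two open quadrants; the witness is the midpoint of its
intersections with the axes. *)
Lemma degenerate_interior_point : 0 < p -> 0 < k -> w1 != 0 ->
  exists x y, 0 < x * y /\ 2 * p * x + k * y = w1.
Proof.
move=> p0 k0 w0; exists (w1 / (4 * p)), (w1 / (2 * k)); split.
  have -> : w1 / (4 * p) * (w1 / (2 * k)) = w1 ^+ 2 / (8 * p * k).
    by field; rewrite !gt_eqF.
  by rewrite divr_gt0 ?exprn_even_gt0 // !mulr_gt0.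
by field; rewrite !gt_eqF.
Qed.

(** The objective is constant on the critical line and grows as the square of
[2 p x + k y - w1] away from it; the line meets the cone, so the minimizers are
exactly the points of the cone on it. *)
Lemma degenerate_cone_minP (x y : R) : 0 < p -> 0 < k -> w1 != 0 ->
  k ^+ 2 = 4 * p * r -> k * w1 = 2 * p * w2 ->
  cone_min x y <-> 0 <= x * y /\ 2 * p * x + k * y = w1.
Proof.
move=> p0 k0 w0 kpr kw.
have kpr' : k ^+ 2 <= 4 * p * r by rewrite kpr.
have crit u v := @degenerate_critical u v p0 kpr kw.
split=> [mxy|[xy /crit cxy]]; last exact: critical_cone_min.
have xy : 0 <= x * y by case: mxy.
have [x0 [y0 [xy0 e0]]] := degenerate_interior_point p0 k0 w0.
have m0 := critical_cone_min p0 kpr' (ltW xy0) (crit _ _ e0).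
split=> //; have /cone_min_eq := crit _ _ e0.
move=> /(_ _ _ m0 xy)[_ /(_ mxy)].
have p4 : 0 < 4 * p by rewrite mulr_gt0.
rewrite -(pmulr_rle0 _ p4) qform_square kpr subrr mul0r addr0.
have -> : 2 * p * (x - x0) + k * (y - y0) = 2 * p * x + k * y - w1.
  by rewrite -e0; ring.
by rewrite exprn_even_le0 //= subr_eq0 => /eqP.
Qed.
End ConeQuadratic.

(** * Singular symmetric matrices *)

Section Matrices.
Variable R : realType.
Implicit Types (G : symM2 R) (a : 'cV[R]_2).

Lemma cv2E (x y : R) : cv2 x y 0 0 = x /\ cv2 x y 1 0 = y.
Proof. by rewrite !mxE. Qed.

Lemma cv2_eta a : a = cv2 (a 0 0) (a 1 0).
Proof.
apply/colP => i; rewrite mxE; case: i => -[|[|//]] hi /=;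
  by congr (a _ _); apply/val_inj.
Qed.

Lemma mulmx22E (a b c d : R) (v : 'cV[R]_2) :
  mx22 a b c d *m v = cv2 (a * v 0 0 + b * v 1 0) (c * v 0 0 + d * v 1 0).
Proof.
by rewrite [LHS]cv2_eta !mxE !big_ord_recl !big_ord0 !mxE /= !addr0;
  congr (cv2 (_ + _ * v _ _) (_ + _ * v _ _)); apply/val_inj.
Qed.

Lemma det_mx22E (a b c d : R) : \det (mx22 a b c d) = a * d - b * c.
Proof. by rewrite det_mx22 !mxE. Qed.

Lemma calGE G : calG G <-> G 0 0 * G 1 1 = G 0 1 ^+ 2.
Proof.
rewrite /calG /= det_mx22 symM2C -expr2.
by split=> [/eqP|->]; [rewrite subr_eq0 => /eqP | rewrite subrr].
Qed.

Lemma PhiE a : Phi a = sym22 (a 0 0) (a 1 0) (Num.sqrt (a 0 0 * a 1 0)).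
Proof.
by rewrite /Phi symbasis_comb -mulrA sqrtrM // mulKf // sqrt2_neq0.
Qed.

Lemma sym22_entries (x y z : R) :
  [/\ sym22 x y z 0 0 = x, sym22 x y z 1 1 = y & sym22 x y z 0 1 = z].
Proof. by rewrite !mxE. Qed.

Lemma Tmap_sym22 (x y z : R) : Tmap (sym22 x y z) = sym22 x y (- z).
Proof. by rewrite /Tmap; have [-> -> ->] := sym22_entries x y z. Qed.

(** The off-diagonal entry of a singular matrix is a square root of the
product of the diagonal ones, hence equals that of [Phi a] up to sign. *)
Lemma Phi_fiberP a G : calGplus a ->
  (G = Phi a \/ G = Tmap (Phi a)) <->
  [/\ calG G, G 0 0 = a 0 0 & G 1 1 = a 1 0].
Proof.
move=> a0; have cP := Phi_calG a0; have cT := Tmap_calG cP.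
split=> [|[/calGE cG g0 g1]].
  by case=> ->; split=> //; rewrite PhiE ?Tmap_sym22 !mxE.
rewrite PhiE Tmap_sym22 [G]sym22E -g0 -g1 cG sqrtr_sqr.
by case: (ler0P (G 0 1)) => _; [right; rewrite opprK | left].
Qed.

Lemma axial_prod0 G : axial G -> G 0 0 * G 1 1 = 0.
Proof.
by case=> _ _ [] /vlineP[c ->]; rewrite !mxE /= mulr0 ?mul0r ?mulr0.
Qed.

Lemma calG_prod0 G : calG G -> G 0 0 * G 1 1 = 0 ->
  (G 1 1 = 0 /\ G = G 0 0 *: G1) \/ (G 0 0 = 0 /\ G = G 1 1 *: G2).
Proof.
move=> /calGE cG xy; have z0 : G 0 1 = 0.
  by apply/eqP; rewrite -sqrf_eq0 -cG xy.
move/eqP: xy; rewrite mulf_eq0 => /orP[] /eqP h0; [right|left]; split=> //.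
  by apply/val_inj/mx22P; rewrite !mxE /= ?symM2C ?h0 ?z0 ?mulr0 ?mulr1.
by apply/val_inj/mx22P; rewrite !mxE /= ?symM2C ?h0 ?z0 ?mulr0 ?mulr1.
Qed.

Lemma interior_calGplus a : interior calGplus a <-> 0 < a 0 0 * a 1 0.
Proof.
split=> [ia|a0]; last first.
  have : (fun b : 'cV[R]_2 => b 0 0 * b 1 0) @ a --> a 0 0 * a 1 0.
    exact: (cvgM (@coord_continuous R 2 1 0 0 a)
                 (@coord_continuous R 2 1 1 0 a)).
  move=> /cvgr_gt /(_ _ a0); apply: filterS => b /ltW; exact.
have a0 : 0 <= a 0 0 * a 1 0 := interior_subset ia.
rewrite lt_neqAle a0 andbT; apply/negP => /eqP e0.
move/nbhs_ballP: ia => [e /= epos He].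
have inball u v : `|u| < e -> `|v| < e ->
    0 <= (a 0 0 + u) * (a 1 0 + v).
  move=> ue ve; have := He (cv2 (a 0 0 + u) (a 1 0 + v)).
  rewrite /calGplus /=; case: (cv2E (a 0 0 + u) (a 1 0 + v)) => -> ->; apply.
  split=> // i j.
  rewrite -ball_normE /= (ord1 j) mxE.
  case: i => -[|[|//]] hi /=.
    have -> : Ordinal hi = 0 by apply/val_inj.
    by rewrite opprD addrA subrr sub0r normrN.
  have -> : Ordinal hi = 1 by apply/val_inj.
  by rewrite opprD addrA subrr sub0r normrN.
have e2 : 0 < e / 2 by rewrite divr_gt0.
have e2e : `|e / 2| < e by rewrite gtr0_norm // ltr_pdivrMr // ltr_pMr // ltr1n.
have e2n : `|- (e / 2)| < e by rewrite normrN.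
(* a zero coordinate is moved to the sign opposite to that of the other one,
   which moves away from 0 in case it vanishes too *)
move/esym/eqP: e0; rewrite mulf_eq0 => /orP[] /eqP h; rewrite h in inball.
  have [y0|y0] := leP 0 (a 1 0).
    by have := inball _ _ e2n e2e; nra.
  by have := inball _ _ e2e e2n; nra.
have [x0|x0] := leP 0 (a 0 0).
  by have := inball _ _ e2e e2n; nra.
by have := inball _ _ e2n e2e; nra.
Qed.
End Matrices.

(** * Reduction to the cone *)

Section Reduction.
Variables (R : realType) (Q : symM2 R -> R) (q1 q2 q12 q3 : R).
Hypotheses (Q_pos : positive_definite Q) (Q_ortho : orthotropic Q q1 q2 q12 q3).

Lemma ortho_comb (c1 c2 c3 : R) : Q (c1 *: G1 + c2 *: G2 + c3 *: G3) =
  c1 ^+ 2 * q1 + c1 * c2 * q12 + c2 ^+ 2 * q2 + c3 ^+ 2 * q3.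
Proof. by rewrite Q_ortho; have [-> -> ->] := hat_comb c1 c2 c3. Qed.

Lemma comb_neq0 (c1 c2 c3 : R) : [|| c1 != 0, c2 != 0 | c3 != 0] ->
  c1 *: G1 + c2 *: G2 + c3 *: G3 != 0 :> symM2 R.
Proof.
move=> c0; apply/eqP => e0; have := hat_comb c1 c2 c3.
rewrite e0 /hat1 /hat2 /hat3 !linear0 => -[e1 e2 e3].
by move: c0; rewrite -e1 -e2 -e3 eqxx.
Qed.

Lemma ortho_gt0 (c1 c2 c3 : R) : [|| c1 != 0, c2 != 0 | c3 != 0] ->
  0 < c1 ^+ 2 * q1 + c1 * c2 * q12 + c2 ^+ 2 * q2 + c3 ^+ 2 * q3.
Proof. by move=> /comb_neq0 /Q_pos; rewrite ortho_comb. Qed.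

Lemma ortho_coef_gt0 : [/\ 0 < q1, 0 < q2, 0 < q3 & q12 ^+ 2 < 4 * q1 * q2].
Proof.
have p1 : 0 < q1.
  by have := @ortho_gt0 1 0 0; rewrite oner_eq0 => /(_ isT); lra.
have p2 : 0 < q2.
  by have := @ortho_gt0 0 1 0; rewrite oner_eq0 orbT => /(_ isT); lra.
have p3 : 0 < q3.
  by have := @ortho_gt0 0 0 1; rewrite oner_eq0 !orbT => /(_ isT); lra.
(* for a fixed second coefficient, - q12 : 2 q1 is where the form is minimal *)
split=> //; have := @ortho_gt0 (- q12) (2 * q1) 0.
rewrite [2 * q1 == 0]gt_eqF ?mulr_gt0 // orbT => /(_ isT).
have -> : (- q12) ^+ 2 * q1 + - q12 * (2 * q1) * q12 + (2 * q1) ^+ 2 * q2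
          + 0 ^+ 2 * q3 = q1 * (4 * q1 * q2 - q12 ^+ 2) by ring.
by rewrite pmulr_rgt0 // subr_gt0.
Qed.

(** The form is the value of Q at [Phi (u, v)], hence positive on the cone; off
the cone it may be negative. *)
Lemma reduced_qform_gt0 (u v : R) : 0 <= u * v -> (u, v) != (0, 0) ->
  0 < qform q1 (q12 + 2 * q3) q2 u v.
Proof.
move=> uv; rewrite xpair_eqE negb_and => uv0.
have := @ortho_gt0 u v (Num.sqrt (2 * (u * v))).
rewrite orbA uv0 sqr_sqrtr; last by rewrite mulr_ge0.
move=> /(_ isT).
by rewrite /qform; congr (0 < _); ring.
Qed.

(** If q12 + 2 q3 <= 0 then q3 > 0 gives q12^2 > (q12 + 2 q3)^2 >= 4 q1 q2,
against the positivity of Q on diagonal matrices. *)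
Lemma offdiag_gt0 : 4 * q1 * q2 <= (q12 + 2 * q3) ^+ 2 -> 0 < q12 + 2 * q3.
Proof.
have [p1 p2 p3 h] := ortho_coef_gt0 => H; rewrite ltNge; apply/negP => n.
by have := lt_le_trans h H; nra.
Qed.

Variable B : symM2 R.
Hypotheses (B_diag : is_diag_mx B) (B_det : \det B != 0).

(* (w1, w2) = 2 A b *)
Let w1 := 2 * q1 * hat1 B + q12 * hat2 B.
Let w2 := q12 * hat1 B + 2 * q2 * hat2 B.
Let S := argmin calG (fun G => Q (G - B)).
Let k := q12 + 2 * q3.
Let cmin := cone_min q1 k q2 w1 w2.
Let obj := objective q1 k q2 w1 w2.

Lemma diag_offdiag0 : B 0 1 = 0.
Proof. by have /is_diag_mxP /(_ 0 1) := B_diag; apply. Qed.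

Lemma energyE G : calG G -> Q (G - B) = obj (G 0 0) (G 1 1) + Q B.
Proof.
move=> /calGE cG; rewrite !Q_ortho /obj /objective /qform /w1 /w2 /k.
have [-> -> ->] := hatE (G - B); have [-> -> ->] := hatE B.
rewrite symM2D !mxE diag_offdiag0 subr0 mulr0 !exprMn sqr_sqrtr // -cG.
ring.
Qed.

Lemma argminP G : S G <-> calG G /\ cmin (G 0 0) (G 1 1).
Proof.
split=> [[cG mG]|[cG [_ mG]]]; split=> //.
- split=> [|x y xy]; first by move/calGE: cG => ->; rewrite sqr_ge0.
  have cP : calGplus (cv2 x y) by rewrite /calGplus /= !mxE.
  have := mG _ (Phi_calG cP); rewrite !energyE //; last exact: Phi_calG.
  by rewrite lerD2r PhiE !mxE.
- move=> G' cG'; rewrite !energyE // lerD2r; apply: mG.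
  by move/calGE: cG' => ->; rewrite sqr_ge0.
Qed.

Lemma argmin_Phi (a : 'cV[R]_2) :
  calGplus a -> cmin (a 0 0) (a 1 0) -> S (Phi a).
Proof.
move=> a0 ma; apply/argminP; split; first exact: Phi_calG.
by rewrite PhiE !mxE.
Qed.

Lemma argmin_nonempty : S !=set0.
Proof.
have [x [y mxy]] := cone_min_exists w1 w2 reduced_qform_gt0.
exists (Phi (cv2 x y)); apply: argmin_Phi; rewrite /calGplus /= !mxE //.
by case: mxy.
Qed.

(** A is invertible because Q is positive on diagonal matrices, so A b = 0
would give b = 0. *)
Lemma load_neq0 : w1 = 0 -> w2 = 0 -> False.
Proof.
have [p1 p2 _ h] := ortho_coef_gt0 => e1 e2; move/negP: B_det; apply.
have : (4 * q1 * q2 - q12 ^+ 2) * hat1 B = 2 * q2 * w1 - q12 * w2.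
  by rewrite /w1 /w2; ring.
rewrite e1 e2 !mulr0 subr0 => /eqP.
rewrite mulf_eq0 subr_eq0 (gt_eqF h) /=; have [-> _ _] := hatE B => /eqP b0.
by rewrite det_mx22 symM2C diag_offdiag0 b0 mul0r mulr0 subr0.
Qed.

(** If 0 were a minimizer, it would be the minimum on both axes, which forces
A b = 0. *)
Lemma argmin_neq0 G : S G -> G != 0.
Proof.
have [p1 p2 _ _] := ortho_coef_gt0; move=> /argminP [_ m]; apply/eqP => e0.
move: m; rewrite e0 !mxE => m0.
have /esym/eqP := cone_min_axis1 p1 m0.
have /esym/eqP := cone_min_axis2 p2 m0.
rewrite !mulf_eq0 !invr_eq0 !mulf_eq0 pnatr_eq0 /=.
rewrite (gt_eqF p1) (gt_eqF p2) !orbF.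
by move=> /eqP e2 /eqP e1; exact: load_neq0.
Qed.

Let P1 : symM2 R := (w1 / (2 * q1)) *: G1.
Let P2 : symM2 R := (w2 / (2 * q2)) *: G2.

Lemma argmin_on_axes G : S G -> G 0 0 * G 1 1 = 0 ->
  axial G /\ (G = P1 \/ G = P2).
Proof.
have [p1 p2 _ _] := ortho_coef_gt0 => SG xy0; have G0 := argmin_neq0 SG.
have /argminP [cG m] := SG.
case: (calG_prod0 cG xy0) => -[z0 eG]; rewrite z0 in m.
  split; first by split=> //; left; apply/vlineP; exists (G 0 0).
  by left; rewrite eG; congr (_ *: _); exact: cone_min_axis1 p1 m.
split; first by split=> //; right; apply/vlineP; exists (G 1 1).
by right; rewrite eG; congr (_ *: _); exact: cone_min_axis2 p2 m.
Qed.

Lemma axis_calG : calG P1 /\ calG P2.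
Proof. by split; apply/calGE; rewrite !mxE /= ?mulr0 ?mul0r expr0n. Qed.

(** With [P1] and [P2] the minimizers on the two axes, the difference of the
minimal values has the sign of b1^2 / q2 - b2^2 / q1. *)
Lemma axis_energyE :
  4 * (Q (P2 - B) - Q (P1 - B)) =
  (4 * q1 * q2 - q12 ^+ 2) * (hat1 B ^+ 2 / q2 - hat2 B ^+ 2 / q1).
Proof.
have [p1 p2 _ _] := ortho_coef_gt0; have [c1 c2] := axis_calG.
rewrite !energyE // !mxE /= /obj /objective /qform /w1 /w2.
by field; rewrite !gt_eqF.
Qed.

Lemma axis_energy_eq :
  Q (P1 - B) = Q (P2 - B) <-> hat2 B ^+ 2 / q1 = hat1 B ^+ 2 / q2.
Proof.
have [_ _ _ h] := ortho_coef_gt0; have := axis_energyE.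
split=> e.
  have /esym/eqP := axis_energyE; rewrite e subrr mulr0 mulf_eq0.
  by rewrite subr_eq0 (gt_eqF h) subr_eq0 => /eqP.
have /eqP := axis_energyE; rewrite e subrr mulr0 mulf_eq0 pnatr_eq0 subr_eq0.
by move=> /eqP.
Qed.

Lemma axial_case : (forall G, S G -> axial G) ->
  [/\ S !=set0, S `<=` [set P1; P2] &
    (S = [set P1; P2] <-> hat2 B ^+ 2 / q1 = hat1 B ^+ 2 / q2)].
Proof.
move=> ax; have sub : S `<=` [set P1; P2].
  by move=> G SG; have [] := argmin_on_axes SG (axial_prod0 (ax _ SG)).
have [c1 c2] := axis_calG.
split=> //; [exact: argmin_nonempty | rewrite -axis_energy_eq; split=> [e|e]].
  have [_ m1] : S P1 by rewrite e; left.
  have [_ m2] : S P2 by rewrite e; right.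
  by apply/eqP; rewrite eq_le m1 // m2.
apply/seteqP; split=> // G.
have [G' SG'] := argmin_nonempty; have [_ mG'] := SG'.
have S1 : S P1.
  split=> // K /mG'; apply: le_trans.
  by case: (sub _ SG') => ->; rewrite ?e.
case=> ->//; case: S1 => _ m1; split=> // K /m1.
by rewrite e.
Qed.

(** * The three cases *)

Let H := Hmx q1 q2 q12 q3.
Let Ab := Amx q1 q2 q12 *m cv2 (hat1 B) (hat2 B).
Let gs : 'cV[R]_2 := 2 *: (invmx H *m Ab).
Let case_a := forall G, S G -> axial G.
Let case_b := 0 < \det H /\ interior calGplus gs.
Let case_c := \det H = 0 /\ range (fun x : 'cV[R]_2 => H *m x) Ab.

Lemma det_Hmx : \det H = 4 * q1 * q2 - k ^+ 2.
Proof. by rewrite /H det_mx22E /k; ring. Qed.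

Lemma AbE : Ab = cv2 (w1 / 2) (w2 / 2).
Proof.
rewrite /Ab mulmx22E; have [-> ->] := cv2E (hat1 B) (hat2 B).
by congr cv2; rewrite /w1 /w2; field.
Qed.

Lemma criticalE (a : 'cV[R]_2) : critical q1 k q2 w1 w2 (a 0 0) (a 1 0) <->
  H *m a = 2 *: Ab.
Proof.
rewrite mulmx22E AbE.
have -> : 2 *: cv2 (w1 / 2) (w2 / 2) = cv2 w1 w2 :> 'cV[R]_2.
  by rewrite [LHS]cv2_eta !mxE /=; congr cv2; field.
split=> [[<- <-] //|e].
by split; [have := congr1 (fun v : 'cV[R]_2 => v 0 0) e
          | have := congr1 (fun v : 'cV[R]_2 => v 1 0) e]; rewrite !mxE.
Qed.

Lemma gs_critical : \det H != 0 -> critical q1 k q2 w1 w2 (gs 0 0) (gs 1 0).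
Proof.
move=> d0; apply/criticalE; rewrite -scalemxAr mulKVmx //.
by rewrite unitmxE unitfE.
Qed.

Lemma critical_gs (a : 'cV[R]_2) : \det H != 0 ->
  critical q1 k q2 w1 w2 (a 0 0) (a 1 0) -> a = gs.
Proof.
move=> d0 /criticalE e; rewrite /gs scalemxAr -e mulKmx //.
by rewrite unitmxE unitfE.
Qed.

(** A minimizer off the axes is critical with H positive semidefinite: it is
g_* if H is invertible, and otherwise H a = 2 A b shows A b in the range. *)
Lemma nonaxial_minimizer G : S G -> 0 < G 0 0 * G 1 1 -> case_b \/ case_c.
Proof.
have [p1 _ _ _] := ortho_coef_gt0 => /argminP[_ m] xy.
pose a := cv2 (G 0 0) (G 1 1); have [a0 a1] := cv2E (G 0 0) (G 1 1).
have ca : critical q1 k q2 w1 w2 (a 0 0) (a 1 0).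
  by rewrite a0 a1; exact: interior_min_critical xy m.
have := interior_min_disc p1 xy m.
rewrite -subr_ge0 -det_Hmx le_eqVlt => /orP[/eqP d0|dpos]; [right|left].
  split=> //; exists (2^-1 *: a) => //.
  rewrite -scalemxAr; move/criticalE: ca => ->.
  by rewrite scalerA mulVf ?scale1r ?pnatr_eq0.
split=> //; apply/interior_calGplus.
by have <- := critical_gs (lt0r_neq0 dpos) ca; rewrite a0 a1.
Qed.

Lemma case_b_argmin : case_b -> S = [set Phi gs; Tmap (Phi gs)].
Proof.
have [p1 _ _ _] := ortho_coef_gt0.
move=> [dpos igs]; have gs0 : calGplus gs := interior_subset igs.
have cgs := gs_critical (lt0r_neq0 dpos).
have kpr : k ^+ 2 < 4 * q1 * q2 by rewrite -subr_gt0 -det_Hmx.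
have mgs := critical_cone_min p1 (ltW kpr) gs0 cgs.
apply/seteqP; split=> G /=.
  move=> /argminP[cG m]; apply/Phi_fiberP => //; split=> //; apply/eqP;
  have /(cone_min_eq cgs mgs) [_ /(_ m)] := proj1 m;
  by move=> /(qform_eq0 p1 kpr) [e1 e2]; rewrite -subr_eq0 ?e1 ?e2.
by move=> /(Phi_fiberP _ gs0) [cG e0 e1]; apply/argminP; rewrite e0 e1.
Qed.

(** What is needed to apply the degenerate theory: A b in the range of H makes
the linear part proportional to the rows of H, and it is nonzero as b is. *)
Lemma case_c_cmin : case_c -> [/\ 0 < k, w1 != 0, k ^+ 2 = 4 * q1 * q2 &
  k * w1 = 2 * q1 * w2].
Proof.
have [p1 _ _ _] := ortho_coef_gt0.
move=> [d0 [v _ /= ev]].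
have kpr : k ^+ 2 = 4 * q1 * q2.
  by apply/esym/eqP; rewrite -subr_eq0 -det_Hmx d0.
have k0 : 0 < k by apply: offdiag_gt0; rewrite -/k kpr.
have cv : critical q1 k q2 w1 w2 ((2 *: v) 0 0) ((2 *: v) 1 0).
  by apply/criticalE; rewrite -scalemxAr ev.
have kw : k * w1 = 2 * q1 * w2.
  by case: cv => <- <-; exact: degenerate_rows.
split=> //; apply/eqP => w10; apply: load_neq0 => //.
move: kw; rewrite w10 mulr0 => /esym/eqP.
by rewrite !mulf_eq0 pnatr_eq0 (gt_eqF p1) /= => /eqP.
Qed.

Let qs := qstar q2 q12 q3.
Let ss := dotv qs Ab / (q1 + q2).

Lemma dotv_qstar u v : dotv (cv2 u v) qs =
  (k * u + 2 * q2 * v) / Num.sqrt (k ^+ 2 + 4 * q2 ^+ 2).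
Proof.
rewrite /dotv !big_ord_recl big_ord0 !mxE /= -/k addr0; ring.
Qed.

(** In the degenerate case H = 2 (q1 + q2) q_* q_*^T, so H a = 2 A b amounts to
a single equation along q_*. *)
Lemma case_c_line (a : 'cV[R]_2) : case_c ->
  dotv a qs = ss <-> 2 * q1 * a 0 0 + k * a 1 0 = w1.
Proof.
have [p1 p2 _ _] := ortho_coef_gt0.
move=> /case_c_cmin [k0 _ kpr kw].
rewrite [a in dotv a]cv2_eta dotv_qstar.
have -> : ss = w2 / Num.sqrt (k ^+ 2 + 4 * q2 ^+ 2).
  have -> : ss = dotv Ab qs / (q1 + q2).
    by rewrite /ss /dotv; congr (_ / _); apply: eq_bigr => i _; rewrite mulrC.
  rewrite AbE dotv_qstar mulrAC; congr (_ / _).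
  have -> : k * (w1 / 2) = q1 * w2 by rewrite mulrA kw; field.
  by field; rewrite gt_eqF // addr_gt0.
have N0 : Num.sqrt (k ^+ 2 + 4 * q2 ^+ 2) != 0.
  by rewrite gt_eqF // sqrtr_gt0 addr_gt0 ?mulr_gt0 ?exprn_gt0.
split=> [/(mulIf (invr_neq0 N0)) e|e].
  by apply: (mulfI (lt0r_neq0 k0)); rewrite kw -e; exact: degenerate_rows.
congr (_ / _).
have [_ //] := degenerate_critical p1 kpr kw e.
Qed.

Lemma case_c_argmin : case_c -> S = [set G | exists a : 'cV[R]_2,
  [/\ calGplus a, dotv a qs = ss & G = Phi a \/ G = Tmap (Phi a)]].
Proof.
move=> cc; have [k0 w0 kpr kw] := case_c_cmin cc.
have [p1 _ _ _] := ortho_coef_gt0.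
apply/seteqP; split=> G /=.
  move=> /argminP[cG /degenerate_cone_minP [] // xy e].
  have [a0 a1] := cv2E (G 0 0) (G 1 1).
  have ca : calGplus (cv2 (G 0 0) (G 1 1)) by rewrite /calGplus /= a0 a1.
  exists (cv2 (G 0 0) (G 1 1)); split=> //.
    by apply/case_c_line => //; rewrite a0 a1.
  by apply/Phi_fiberP => //; rewrite a0 a1.
move=> [a [ca /(case_c_line _ cc) e]] /(Phi_fiberP _ ca) [cG e0 e1].
apply/argminP; split=> //; rewrite e0 e1.
by apply/degenerate_cone_minP.
Qed.

(** Cases (b) and (c) each produce a minimizer off the axes, which excludes
(a); if both fail, no minimizer is off the axes. *)
Lemma trichotomy : exactly_one_of3 case_a case_b case_c.
Proof.
have [p1 _ _ _] := ortho_coef_gt0.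
have nax x y : 0 < x * y -> cmin x y -> ~ case_a.
  move=> xy m ca; have [a0 a1] := cv2E x y.
  have cx : calGplus (cv2 x y) by rewrite /calGplus /= a0 a1 ltW.
  have := argmin_Phi cx; rewrite a0 a1 => /(_ m) /ca /axial_prod0.
  by rewrite PhiE !mxE /= => e; rewrite e ltxx in xy.
split.
  have [b|nb] := pselect case_b; first by constructor 2.
  have [c|nc] := pselect case_c; first by constructor 3.
  constructor 1 => G SG.
  have [xy|xy] := ltP 0 (G 0 0 * G 1 1).
    by case: (nonaxial_minimizer SG xy).
  apply: (proj1 (argmin_on_axes SG _)).
  apply/eqP; rewrite eq_le xy /=.
  by case/argminP: SG => /calGE -> _; rewrite sqr_ge0.
split.
- move=> [ca cb]; have [dpos /interior_calGplus gpos] := cb.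
  have : S (Phi gs) by rewrite case_b_argmin //; left.
  move=> /argminP [_ m]; apply: (nax _ _ gpos) ca.
  by move: m; rewrite PhiE !mxE.
- move=> [ca cc]; have [k0 w0 kpr kw] := case_c_cmin cc.
  have [x [y [xy e]]] := degenerate_interior_point p1 k0 w0.
  apply: (nax _ _ xy) ca; apply/degenerate_cone_minP => //.
  by split=> //; exact: ltW.
- by move=> [[dpos _] [d0 _]]; rewrite d0 ltxx in dpos.
Qed.
End Reduction.

Theorem lemma5p3 (R : realType) (Q : symM2 R -> R) (q1 q2 q12 q3 : R)
    (B : symM2 R)
    (Q_quad : quadratic_form Q) (Q_pos : positive_definite Q)
    (Q_ortho : orthotropic Q q1 q2 q12 q3)
    (B_diag : is_diag_mx B) (B_det : \det B != 0) :
  let S := argmin calG (fun G => Q (G - B)) in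
  let H := Hmx q1 q2 q12 q3 in
  let A := Amx q1 q2 q12 in
  let b := cv2 (hat1 B) (hat2 B) in
  let gs := 2 *: (invmx H *m (A *m b)) in
  let qs := qstar q2 q12 q3 in
  let ss := dotv qs (A *m b) / (q1 + q2) in
  let P1 := ((2 * q1 * hat1 B + q12 * hat2 B) / (2 * q1)) *: G1 in
  let P2 := ((q12 * hat1 B + 2 * q2 * hat2 B) / (2 * q2)) *: G2 in
  let case_a := forall G, S G -> axial G in
  let case_b := 0 < \det H /\ interior calGplus gs in
  let case_c := \det H = 0 /\ range (fun x : 'cV[R]_2 => H *m x) (A *m b) in
  [/\ exactly_one_of3 case_a case_b case_c,
      case_a ->
        [/\ S !=set0, S `<=` [set P1; P2] &
          (S = [set P1; P2] <-> hat2 B ^+ 2 / q1 = hat1 B ^+ 2 / q2)],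
      case_b -> S = [set Phi gs; Tmap (Phi gs)] &
      case_c ->
        S = [set G | exists a : 'cV[R]_2,
               [/\ calGplus a, dotv a qs = ss & G = Phi a \/ G = Tmap (Phi a)]]].
Proof.
move=> S H A b gs qs ss P1 P2 case_a case_b case_c; split.
- exact: trichotomy.
- exact: axial_case.
- exact: case_b_argmin.
- exact: case_c_argmin.
Qed.
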